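(* There is an integer $k \geq 1$ such that there is no refuter $R(1^n,E_n)$ for $\mathsf{SAT}_n$ against $E_n \in \mathsf{coNSIZE}[n^k]$ of nonuniform polynomial size which succeeds on every large enough input length. That is, there is no family of Boolean circuits $\{R_n\}$ of size polynomial in $n$ such that for all sufficiently large $n$ and every co-nondeterministic circuit $E_n$ on $n$ input bits of size at most $n^k$, $R_n(E_n)$ outputs $x\in\{0,1\}^n$ with $E_n(x)\neq\mathsf{SAT}_n(x)$.
   Context: $\mathsf{SAT}_n$ denotes the decision version of the satisfiability problem for De Morgan Boolean formulas represented by $n$-bit strings. A co-nondeterministic circuit $E(x,z)$ computes $E(x)=1$ iff $E(x,z)=1$ for all nondeterministic inputs $z$; $\mathsf{coNSIZE}[s(n)]$ denotes co-nondeterministic circuits of size $s(n)$. *)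

(* Defs.v *)
From HB Require Import structures.
From mathcomp Require Import all_boot.

Set Implicit Arguments.
Unset Strict Implicit.
Unset Printing Implicit Defensive.

(* Little-endian binary expansion of i on w bits; faithful when i < 2 ^ w. *)
Definition bits (w i : nat) : bitseq := mkseq (fun j => odd (i %/ 2 ^ j)) w.

(* A circuit is a straight-line program over the De Morgan basis.  Wires are
   numbered 0, ..., l - 1 for the l inputs, then l, l + 1, ... for the gates in
   the order in which they are listed. *)
Inductive gate :=
  | GConst of bool
  | GNot of nat
  | GAnd of nat & nat
  | GOr of nat & nat.

Definition gate_args (g : gate) : seq nat :=
  match g with
  | GConst _ => [::]
  | GNot a => [:: a]
  | GAnd a b | GOr a b => [:: a; b]
  end.

Definition eval_gate (v : bitseq) (g : gate) : bool :=
  match g with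
  | GConst b => b
  | GNot a => ~~ nth false v a
  | GAnd a b => nth false v a && nth false v b
  | GOr a b => nth false v a || nth false v b
  end.

(* Each gate only reads wires with a smaller number, so the graph is acyclic. *)
Fixpoint wf_gates (l : nat) (gs : seq gate) : bool :=
  if gs is g :: gs' then all (fun a => a < l) (gate_args g) && wf_gates l.+1 gs'
  else true.

Record circuit (l m : nat) := Circuit {
  gates : seq gate;
  outs : m.-tuple nat;
  circuit_wf : wf_gates l gates && all (fun a => a < l + size gates) outs
}.

(* Number of vertices of the circuit, input vertices included. *)
Definition circuit_size (l m : nat) (C : circuit l m) : nat :=
  l + size (gates C).

Definition eval_wires (gs : seq gate) (x : bitseq) : bitseq :=
  foldl (fun v g => rcons v (eval_gate v g)) x gs.

Definition eval_circuit (l m : nat) (C : circuit l m) (x : l.-tuple bool) :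
  m.-tuple bool :=
  [tuple of map (nth false (eval_wires (gates C) x)) (outs C)].

Record coNcircuit (n : nat) := CoNCircuit {
  nondet : nat;
  coN_circuit : circuit (n + nondet) 1
}.

Definition coN_size (n : nat) (E : coNcircuit n) : nat :=
  circuit_size (coN_circuit E).

Definition coN_eval (n : nat) (E : coNcircuit n) (x : n.-tuple bool) : bool :=
  [forall z : (nondet E).-tuple bool,
     thead (eval_circuit (coN_circuit E) [tuple of x ++ z])].

Definition code_gate (w : nat) (g : gate) : bitseq :=
  match g with
  | GConst b => [:: false; false; b] ++ bits w 0 ++ bits w 0
  | GNot a => [:: false; true; false] ++ bits w a ++ bits w 0
  | GAnd a b => [:: true; false; false] ++ bits w a ++ bits w b
  | GOr a b => [:: true; true; false] ++ bits w a ++ bits w b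
  end.

Definition code_width (s : nat) : nat := up_log 2 s.+1.

Definition code_len (s : nat) : nat :=
  3 * code_width s + s * (3 + 2 * code_width s).

Definition coN_code_seq (s n : nat) (E : coNcircuit n) : bitseq :=
  let w := code_width s in
  let C := coN_circuit E in
  bits w (nondet E) ++ bits w (size (gates C)) ++ bits w (thead (outs C)) ++
  flatten (map (code_gate w) (gates C)).

(* The sequence above, padded with zeros to the length code_len s, which is
   common to all circuits of size at most s; see [size_coN_code_seq]. *)
Definition coN_code (s n : nat) (E : coNcircuit n) : (code_len s).-tuple bool :=
  [tuple nth false (coN_code_seq s E) i | i < code_len s].

Inductive form (n : nat) :=
  | FConst of bool
  | FVar of 'I_n
  | FNot of form n
  | FAnd of form n & form n
  | FOr of form n & form n.

Fixpoint eval_form (n : nat) (a : n.-tuple bool) (p : form n) : bool :=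
  match p with
  | FConst b => b
  | FVar i => tnth a i
  | FNot q => ~~ eval_form a q
  | FAnd q r => eval_form a q && eval_form a r
  | FOr q r => eval_form a q || eval_form a r
  end.

(* Prefix (Polish) notation with prefix-free tags, a variable being written
   in binary on the ceiling of log2 n bits. *)
Fixpoint code_form (n : nat) (p : form n) : bitseq :=
  match p with
  | FConst b => [:: false; false; b]
  | FVar i => [:: false; true; false] ++ bits (up_log 2 n) i
  | FNot q => [:: false; true; true] ++ code_form q
  | FAnd q r => [:: true; false] ++ code_form q ++ code_form r
  | FOr q r => [:: true; true] ++ code_form q ++ code_form r
  end.

(* An n-bit string represents a formula over the variables x_0, ..., x_(n-1)
   (an n-bit string has room for fewer than n occurrences of variables) when it
   is the code of that formula padded with zeros. *)
Definition represents (n : nat) (x : n.-tuple bool) (p : form n) : Prop :=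
  exists j : nat, tval x = code_form p ++ nseq j false.

(* Strings that represent no formula are negative instances. *)
Definition SAT (n : nat) (x : n.-tuple bool) : Prop :=
  exists2 p : form n, represents x p & exists a, eval_form a p.

(* R n reads the description of a co-nondeterministic circuit of size at most
   n ^ k on n inputs, and outputs n bits. *)
Definition refuter_family (k : nat) : Type :=
  forall n : nat, circuit (code_len (n ^ k)) n.

Definition poly_size (k : nat) (R : refuter_family k) : Prop :=
  exists c : nat, forall n : nat, circuit_size (R n) <= n ^ c + c.

Definition refutes_at (k : nat) (R : refuter_family k) (n : nat) : Prop :=
  forall E : coNcircuit n, coN_size E <= n ^ k ->
    let x := eval_circuit (R n) (coN_code (n ^ k) E) in
    ~ (coN_eval E x <-> SAT x).

Lemma size_bits w i : size (bits w i) = w.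
Proof. by rewrite size_mkseq. Qed.

Lemma bits_inj w i j : i < 2 ^ w -> j < 2 ^ w -> bits w i = bits w j -> i = j.
Proof.
elim: w i j => [|w IH] i j; first by rewrite expn0 !ltnS !leqn0 => /eqP-> /eqP->.
have bitsS u : bits w.+1 u = odd u :: bits w u./2.
  rewrite /bits /mkseq /= expn0 divn1 -[1]/(1 + 0) iotaDl -map_comp.
  congr (_ :: _); apply: eq_map => t /=.
  by rewrite add1n expnS divnMA divn2.
rewrite !bitsS expnS mul2n => li lj [eo eh].
rewrite -(odd_double_half i) -(odd_double_half j) eo; congr (_ + _.*2).
by apply: IH eh; rewrite ltn_half_double.
Qed.

Lemma size_code_gate w g : size (code_gate w g) = 3 + 2 * w.
Proof. by case: g => *; rewrite !size_cat !size_bits mul2n addnn. Qed.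

Lemma size_coN_code_seq s n (E : coNcircuit n) :
  coN_size E <= s -> size (coN_code_seq s E) <= code_len s.
Proof.
rewrite /coN_size /circuit_size => les.
have size_gs gs : size (flatten (map (code_gate (code_width s)) gs)) =
    size gs * (3 + 2 * code_width s).
  by elim: gs => //= g gs IH; rewrite size_cat IH size_code_gate mulSn.
rewrite /coN_code_seq !size_cat !size_bits size_gs /code_len !addnA.
rewrite mulSn mul2n -addnn addnA leq_add2l leq_mul2r.
by rewrite (leq_trans (leq_addl _ _) les) orbT.
Qed.

Lemma coN_codeE s n (E : coNcircuit n) : coN_size E <= s ->
  exists j, tval (coN_code s E) = coN_code_seq s E ++ nseq j false.
Proof.
move=> /size_coN_code_seq le_len.
exists (code_len s - size (coN_code_seq s E)).
apply: (@eq_from_nth _ false); first by rewrite size_tuple size_cat size_nseq subnKC.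
move=> i; rewrite size_tuple => lti.
rewrite -[i]/(val (Ordinal lti)) -tnth_nth tnth_mktuple /= nth_cat nth_nseq.
by case: ltnP => // ge_i; rewrite nth_default // if_same.
Qed.

Lemma code_gate_inj w g g' u v :
  all (fun a => a < 2 ^ w) (gate_args g) ->
  all (fun a => a < 2 ^ w) (gate_args g') ->
  code_gate w g ++ u = code_gate w g' ++ v -> g = g' /\ u = v.
Proof.
have bitsI i j (x y : bitseq) : bits w i ++ x = bits w j ++ y ->
    bits w i = bits w j /\ x = y.
  by move/eqP; rewrite eqseq_cat ?size_bits // => /andP[/eqP-> /eqP->].
case: g => [b|a|a b|a b]; case: g' => [b'|a'|a' b'|a' b'] //=; rewrite -?catA.
- by move=> _ _ [-> /bitsI[_ /bitsI[_ ->]]].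
- rewrite !andbT => la la' [/bitsI[e /bitsI[_ ->]]].
  by rewrite (bits_inj la la' e).
- rewrite !andbT => /andP[la lb] /andP[la' lb'] [/bitsI[ea /bitsI[eb ->]]].
  by rewrite (bits_inj la la' ea) (bits_inj lb lb' eb).
- rewrite !andbT => /andP[la lb] /andP[la' lb'] [/bitsI[ea /bitsI[eb ->]]].
  by rewrite (bits_inj la la' ea) (bits_inj lb lb' eb).
Qed.

Lemma coN_code_inj s n (E E' : coNcircuit n) :
  coN_size E <= s -> coN_size E' <= s -> coN_code s E = coN_code s E' -> E = E'.
Proof.
move=> les les' /(congr1 val) /=.
have [j ->] := coN_codeE les; have [j' ->] := coN_codeE les'.
move: les les'; rewrite /coN_size /circuit_size /coN_code_seq -!catA.
set w := code_width s.
have lt2w i : i <= s -> i < 2 ^ w by move=> ?; apply: leq_trans (up_logP _ _).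
have bitsI i i' (x y : bitseq) : i <= s -> i' <= s ->
    bits w i ++ x = bits w i' ++ y -> i = i' /\ x = y.
  move=> /lt2w li /lt2w li' /eqP; rewrite eqseq_cat ?size_bits //.
  by move=> /andP[/eqP/(bits_inj li li')-> /eqP->].
have gatesI l gs gs' (x y : bitseq) : l + size gs <= s -> size gs = size gs' ->
    wf_gates l gs -> wf_gates l gs' ->
    flatten (map (code_gate w) gs) ++ x = flatten (map (code_gate w) gs') ++ y ->
    gs = gs'.
  elim: gs gs' l => [|g gs IH] [|g' gs'] l //=; rewrite -!catA.
  move=> les [esz] /andP[ag wg] /andP[ag' wg'].
  have lt_l a : a < l -> a < 2 ^ w.
    by move=> lt_a; apply/lt2w/(leq_trans (ltnW lt_a))/(leq_trans _ les)/leq_addr.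
  have sub g0 : all (fun a => a < l) (gate_args g0) ->
      all (fun a => a < 2 ^ w) (gate_args g0) by apply: sub_all.
  move=> /(code_gate_inj (sub _ ag) (sub _ ag'))[-> e].
  by rewrite (IH gs' l.+1) // addSnnS.
case: E E' => [r [gs o wf]] [r' [gs' o' wf']] /=.
move=> les les'.
have ler : r <= s by rewrite (leq_trans _ les) // addnAC leq_addl.
have ler' : r' <= s by rewrite (leq_trans _ les') // addnAC leq_addl.
have leg : size gs <= s := leq_trans (leq_addl _ _) les.
have leg' : size gs' <= s := leq_trans (leq_addl _ _) les'.
have theadE (t : 1.-tuple nat) : tval t = [:: thead t].
  by case/tupleP: t => a t; rewrite theadE (tuple0 t).
move=> /(bitsI _ _ _ _ ler ler')[er].
move: er wf' les' => <- wf' les' /(bitsI _ _ _ _ leg leg')[eg].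
case/andP: (wf) => wg; rewrite theadE /= andbT => /ltnW lo.
case/andP: (wf') => wg'; rewrite theadE /= andbT => /ltnW lo'.
move=> /(bitsI _ _ _ _ (leq_trans lo les) (leq_trans lo' les'))[eo].
move=> /(gatesI _ _ _ _ _ les eg wg wg') egs.
have eo' : o = o' by apply: val_inj; rewrite /= (theadE o) (theadE o') eo.
by move: wf wf'; rewrite egs eo' => wf wf'; rewrite (bool_irrelevance wf wf').
Qed.

Lemma code_form_inj n (p q : form n) u v :
  code_form p ++ u = code_form q ++ v -> p = q /\ u = v.
Proof.
elim: p q u v => [b|i|p IH|p IHp r IHr|p IHp r IHr]
  [b'|j|p'|p' r'|p' r'] u v //=.
- by case=> -> ->.
- case=> /eqP; rewrite eqseq_cat ?size_bits // => /andP[/eqP e /eqP ->].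
  split=> //; congr FVar; apply/val_inj/(bits_inj _ _ e);
    exact: leq_trans (ltn_ord _) (up_logP _ _).
- by case=> /IH[-> ->].
- by case; rewrite -!catA => /IHp[-> /IHr[-> ->]].
- by case; rewrite -!catA => /IHp[-> /IHr[-> ->]].
Qed.

Lemma represents_uniq n (x : n.-tuple bool) (p q : form n) :
  represents x p -> represents x q -> p = q.
Proof. by move=> [i e] [j]; rewrite e => /code_form_inj[]. Qed.

(* Main.v *)
Require Import Defs.
From mathcomp Require Import all_boot.
From mathcomp Require Import zify boolp.

(** Suppose that there is a refuter for every exponent.  For n strings
    x_1, ..., x_n of length n, the co-nondeterministic circuit
    E(y) = "no z satisfies any of the x_i" ignores y and has size n ^ k for a
    fixed k, so the refuter at exponent k turns it into a string f(x_1, ..., x_n)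
    of length n which is satisfiable iff some x_i is: it compresses the OR of n
    instances to one instance of the same length.

    Counting as in Fortnow and Santhanam then puts SAT in coNP/poly: among the
    tuples over a set S of unsatisfiable strings, some value y of f is hit by
    tuples whose entries cover at least half of S, hence n + 1 unsatisfiable
    values y_j suffice to cover all unsatisfiable strings.  So x is
    unsatisfiable iff it occurs in a tuple that f maps to one of the y_j, and the
    code of E depends on the x_i only through the constants hardwired in it.
    The resulting co-nondeterministic circuits for SAT have size n ^ d for some
    d, which contradicts the refuter at exponent d.

    Circuits are obtained by compiling Boolean expressions: every intermediate
    value (parse table of a formula, wires of the refuter) is guessed, and only
    local consistency has to be expressed. *)

Set Implicit Arguments.
Unset Strict Implicit.
Unset Printing Implicit Defensive.

(** * Boolean expressions and their compilation *)

Inductive bexp (T : Type) :=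
  | BVar of T
  | BConst of bool
  | BNot of bexp T
  | BAnd of bexp T & bexp T
  | BOr of bexp T & bexp T.
Arguments BConst {T}.

Fixpoint beval T (r : T -> bool) (e : bexp T) : bool :=
  match e with
  | BVar t => r t
  | BConst b => b
  | BNot f => ~~ beval r f
  | BAnd f g => beval r f && beval r g
  | BOr f g => beval r f || beval r g
  end.

Fixpoint bsize T (e : bexp T) : nat :=
  match e with
  | BVar _ | BConst _ => 1
  | BNot f => (bsize f).+1
  | BAnd f g | BOr f g => (bsize f + bsize g).+1
  end.

Fixpoint bmap T U (h : T -> U) (e : bexp T) : bexp U :=
  match e with
  | BVar t => BVar (h t)
  | BConst b => BConst b
  | BNot f => BNot (bmap h f)
  | BAnd f g => BAnd (bmap h f) (bmap h g)
  | BOr f g => BOr (bmap h f) (bmap h g)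
  end.

Definition blit T (e : bexp T) (b : bool) : bexp T := if b then e else BNot e.

Definition beqv T (e f : bexp T) : bexp T :=
  BOr (BAnd e f) (BAnd (BNot e) (BNot f)).

Definition ball T (I : Type) (s : seq I) (F : I -> bexp T) : bexp T :=
  foldr (fun i => BAnd (F i)) (BConst true) s.

Definition bex T (I : Type) (s : seq I) (F : I -> bexp T) : bexp T :=
  foldr (fun i => BOr (F i)) (BConst false) s.

Lemma bsize_gt0 T (e : bexp T) : 0 < bsize e.
Proof. by case: e. Qed.

Lemma bsizeE T : (forall t : T, bsize (BVar t) = 1) *
  (forall b, bsize (@BConst T b) = 1) *
  (forall e : bexp T, bsize (BNot e) = (bsize e).+1) *
  (forall e f : bexp T, bsize (BAnd e f) = (bsize e + bsize f).+1) *
  (forall e f : bexp T, bsize (BOr e f) = (bsize e + bsize f).+1).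
Proof. by []. Qed.

Lemma eq_beval T (r r' : T -> bool) e : r =1 r' -> beval r e = beval r' e.
Proof. by move=> rr; elim: e => //= [f ->|f -> g ->|f -> g ->]. Qed.

Lemma beval_map T U (h : T -> U) r e : beval r (bmap h e) = beval (r \o h) e.
Proof. by elim: e => //= [f ->|f -> g ->|f -> g ->]. Qed.

Lemma bsize_map T U (h : T -> U) e : bsize (bmap h e) = bsize e.
Proof. by elim: e => //= [f ->|f -> g ->|f -> g ->]. Qed.

Lemma bnotP T (r : T -> bool) e : reflect (~ beval r e) (beval r (BNot e)).
Proof. exact: negP. Qed.

Lemma bandP T (r : T -> bool) e f :
  reflect (beval r e /\ beval r f) (beval r (BAnd e f)).
Proof. exact: andP. Qed.

Lemma borP T (r : T -> bool) e f :
  reflect (beval r e \/ beval r f) (beval r (BOr e f)).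
Proof. exact: orP. Qed.

Lemma beval_lit T (r : T -> bool) e b : beval r (blit e b) = (beval r e == b).
Proof. by case: b => /=; case: (beval r e). Qed.

Lemma bsize_lit T (e : bexp T) b : bsize (blit e b) <= (bsize e).+1.
Proof. by case: b => /=. Qed.

Lemma beval_eqv T (r : T -> bool) e f :
  beval r (beqv e f) = (beval r e == beval r f).
Proof. by rewrite /=; case: (beval r e); case: (beval r f). Qed.

Lemma beval_all T I (r : T -> bool) (s : seq I) F :
  beval r (ball s F) = all (fun i => beval r (F i)) s.
Proof. by elim: s => //= i s ->. Qed.

Lemma beval_ex T I (r : T -> bool) (s : seq I) F :
  beval r (bex s F) = has (fun i => beval r (F i)) s.
Proof. by elim: s => //= i s ->. Qed.

Lemma bsize_all T I (s : seq I) (F : I -> bexp T) m :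
  (forall i, bsize (F i) <= m) -> bsize (ball s F) <= (size s * m.+1).+1.
Proof. by move=> le_m; elim: s => //= i s; have := le_m i; lia. Qed.

Lemma bsize_ex T I (s : seq I) (F : I -> bexp T) m :
  (forall i, bsize (F i) <= m) -> bsize (bex s F) <= (size s * m.+1).+1.
Proof. by move=> le_m; elim: s => //= i s; have := le_m i; lia. Qed.

(** * Runs of straight-line programs *)

Lemma eval_wires_cat gs gs' x :
  eval_wires (gs ++ gs') x = eval_wires gs' (eval_wires gs x).
Proof. exact: foldl_cat. Qed.

Lemma eval_wires_rcons gs g x : eval_wires (rcons gs g) x =
  rcons (eval_wires gs x) (eval_gate (eval_wires gs x) g).
Proof. exact: foldl_rcons. Qed.

Lemma wf_gates_cat l gs gs' :
  wf_gates l (gs ++ gs') = wf_gates l gs && wf_gates (l + size gs) gs'.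
Proof.
elim: gs l => [|g gs IH] l /=; first by rewrite addn0.
by rewrite IH addSnnS andbA.
Qed.

Lemma wf_gates_rcons l gs g : wf_gates l (rcons gs g) =
  wf_gates l gs && all (fun a => a < l + size gs) (gate_args g).
Proof. by rewrite -cats1 wf_gates_cat /= andbT. Qed.

Lemma eval_gate_eq (v v' : bitseq) l g : all (fun a => a < l) (gate_args g) ->
  (forall a, a < l -> nth false v a = nth false v' a) ->
  eval_gate v g = eval_gate v' g.
Proof.
move=> + vv'; case: g => //= [a|a b|a b]; rewrite andbT.
- by move=> /vv'->.
- by case/andP=> /vv'-> /vv'->.
- by case/andP=> /vv'-> /vv'->.
Qed.

Lemma size_eval_wires gs x : size (eval_wires gs x) = size x + size gs.
Proof.
elim: gs x => [|g gs IH] x; first by rewrite addn0.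
by rewrite /= IH size_rcons addSnnS.
Qed.

Lemma eval_wires_prefix gs x : exists s, eval_wires gs x = x ++ s.
Proof.
elim: gs x => [|g gs IH] x; first by exists [::]; rewrite cats0.
have [s es] := IH (rcons x (eval_gate x g)).
by exists (eval_gate x g :: s); rewrite /= -cat_rcons -es.
Qed.

(** A run is characterised by one local equation per gate, so a guessed wire vector can be checked
    by a conjunction of small conditions. The induction treats the first gate, once evaluated, as
    one more input. *)
Lemma eval_wiresP l gs (v : bitseq) : wf_gates l gs -> size v = l + size gs ->
  v = eval_wires gs (take l v) <->
  forall j, j < size gs ->
    nth false v (l + j) = eval_gate v (nth (GConst false) gs j).
Proof.
elim: gs l => [|g gs IH] l.
  by move=> _ sv; rewrite take_oversize // sv addn0.
move=> /= /andP[ag wg] sv.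
have lv : l < size v by rewrite sv; lia.
have -> : eval_gate (take l v) g = eval_gate v g.
  by apply: (eval_gate_eq ag) => a al; rewrite nth_take.
have IHl : v = eval_wires gs (take l.+1 v) <-> _ :=
  IH _ wg (etrans sv (esym (addSnnS _ _))).
rewrite (take_nth false lv) in IHl.
split=> [ev|H].
  have nb : nth false v l = eval_gate v g.
    have [s es] := eval_wires_prefix gs (rcons (take l v) (eval_gate v g)).
    have st : size (take l v) = l by rewrite size_takel // ltnW.
    by rewrite [in LHS]ev es cat_rcons nth_cat st ltnn subnn.
  rewrite nb in IHl; case=> [_|j]; first by rewrite addn0.
  by rewrite ltnS -addSnnS; apply: IHl.1.
have nb := H 0 isT; rewrite addn0 /= in nb; rewrite nb in IHl.
by apply/IHl => j lj; rewrite addSnnS H.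
Qed.

(* A variable is copied by a gate, so that the value of the expression is always
   that of the last gate. *)
Fixpoint compile T (v : T -> nat) (l : nat) (e : bexp T) : seq gate :=
  match e with
  | BVar t => [:: GAnd (v t) (v t)]
  | BConst b => [:: GConst b]
  | BNot f => rcons (compile v l f) (GNot (l + bsize f).-1)
  | BAnd f g => rcons (compile v l f ++ compile v (l + bsize f) g)
                  (GAnd (l + bsize f).-1 (l + bsize f + bsize g).-1)
  | BOr f g => rcons (compile v l f ++ compile v (l + bsize f) g)
                  (GOr (l + bsize f).-1 (l + bsize f + bsize g).-1)
  end.

Lemma size_compile T (v : T -> nat) l e : size (compile v l e) = bsize e.
Proof.
elim: e l => //= [f IH|f IHf g IHg|f IHf g IHg] l;
  by rewrite size_rcons ?size_cat ?IH ?IHf ?IHg.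
Qed.

Lemma compile_wf T (v : T -> nat) l e :
  (forall t, v t < l) -> wf_gates l (compile v l e).
Proof.
elim: e l => //= [t|f IH|f IHf g IHg|f IHf g IHg] l vl.
- by rewrite !vl.
- by rewrite wf_gates_rcons IH //= size_compile; have := bsize_gt0 f; lia.
- rewrite wf_gates_rcons wf_gates_cat IHf // size_cat !size_compile IHg //=.
    by have := bsize_gt0 f; have := bsize_gt0 g; lia.
  by move=> t; apply: leq_trans (vl t) (leq_addr _ _).
- rewrite wf_gates_rcons wf_gates_cat IHf // size_cat !size_compile IHg //=.
    by have := bsize_gt0 f; have := bsize_gt0 g; lia.
  by move=> t; apply: leq_trans (vl t) (leq_addr _ _).
Qed.

(** The run only appends wires to [x]. This is what lets the second operand be compiled on top of
    the wires of the first without changing the values of the variables. *)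
Lemma compile_eval T (v : T -> nat) (x : bitseq) e :
  (forall t, v t < size x) ->
  exists s : bitseq, [/\ size s = bsize e,
    eval_wires (compile v (size x) e) x = x ++ s &
    nth false (x ++ s) (size x + bsize e).-1 =
      beval (fun t => nth false x (v t)) e].
Proof.
elim: e x => /= [t|b|f IH|f IHf g IHg|f IHf g IHg] x vx.
- exists [:: nth false x (v t)]; rewrite /= andbb cats1; split=> //.
  by rewrite addn1 nth_rcons ltnn eqxx.
- by exists [:: b]; rewrite cats1 addn1 nth_rcons ltnn eqxx.
- have [s [ss es ns]] := IH x vx.
  exists (rcons s (~~ beval (fun t => nth false x (v t)) f)).
  rewrite size_rcons ss eval_wires_rcons es -rcons_cat /= ns; split=> //.
  by rewrite addnS /= nth_rcons size_cat ss ltnn eqxx.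
- have [s [ss es ns]] := IHf x vx.
  have vx' t : v t < size (x ++ s).
    by rewrite size_cat (leq_trans (vx t)) ?leq_addr.
  have [s' [ss' es' ns']] := IHg _ vx'.
  have ns2 : nth false ((x ++ s) ++ s') (size x + bsize f).-1 =
             beval (fun t => nth false x (v t)) f.
    rewrite nth_cat size_cat ss ns ifT //.
    by have := bsize_gt0 f; lia.
  rewrite size_cat ss in es' ns'.
  have eg : beval (fun t => nth false (x ++ s) (v t)) g =
            beval (fun t => nth false x (v t)) g.
    by apply: eq_beval => t; rewrite nth_cat vx.
  rewrite eg in ns'.
  exists (rcons (s ++ s') (beval (fun t => nth false x (v t)) (BAnd f g))).
  rewrite size_rcons size_cat ss ss' eval_wires_rcons eval_wires_cat es es'.
  rewrite -rcons_cat catA /= ns2 ns'; split=> //.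
  by rewrite addnS addnA /= nth_rcons !size_cat ss ss' ltnn eqxx.
- have [s [ss es ns]] := IHf x vx.
  have vx' t : v t < size (x ++ s).
    by rewrite size_cat (leq_trans (vx t)) ?leq_addr.
  have [s' [ss' es' ns']] := IHg _ vx'.
  have ns2 : nth false ((x ++ s) ++ s') (size x + bsize f).-1 =
             beval (fun t => nth false x (v t)) f.
    rewrite nth_cat size_cat ss ns ifT //.
    by have := bsize_gt0 f; lia.
  rewrite size_cat ss in es' ns'.
  have eg : beval (fun t => nth false (x ++ s) (v t)) g =
            beval (fun t => nth false x (v t)) g.
    by apply: eq_beval => t; rewrite nth_cat vx.
  rewrite eg in ns'.
  exists (rcons (s ++ s') (beval (fun t => nth false x (v t)) (BOr f g))).
  rewrite size_rcons size_cat ss ss' eval_wires_rcons eval_wires_cat es es'.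
  rewrite -rcons_cat catA /= ns2 ns'; split=> //.
  by rewrite addnS addnA /= nth_rcons !size_cat ss ss' ltnn eqxx.
Qed.

(* The circuit forall z, e(x, X, z) in which the bits of X are the constants of the
   first gates: each bit of its code is constant or a single bit of X. *)
Section Hardwired.
Variables (n : nat) (A Z : finType) (e : bexp ('I_n + (A + Z))).

(** The bits of [X] are gates, so their wires come after the inputs and the nondeterministic
    bits. *)
Definition hw_wire (t : 'I_n + (A + Z)) : nat :=
  match t with
  | inl i => i
  | inr (inl a) => n + #|Z| + enum_rank a
  | inr (inr z) => n + enum_rank z
  end.

Definition hw_env (x : n.-tuple bool) (X : A -> bool) (r : Z -> bool)
    (t : 'I_n + (A + Z)) : bool :=
  match t with
  | inl i => tnth x i
  | inr (inl a) => X a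
  | inr (inr z) => r z
  end.

Definition hw_gates (X : A -> bool) : seq gate :=
  [seq GConst (X a) | a <- enum A] ++ compile hw_wire (n + #|Z| + #|A|) e.

Definition hw_out : nat := (n + #|Z| + #|A| + bsize e).-1.

Lemma size_hw_gates X : size (hw_gates X) = #|A| + bsize e.
Proof. by rewrite size_cat size_map -cardE size_compile. Qed.

Lemma hw_wire_lt t : hw_wire t < n + #|Z| + #|A|.
Proof.
case: t => [i|[a|z]] /=.
- by rewrite -addnA ltn_addr.
- by rewrite ltn_add2l.
- by rewrite -addnA ltn_add2l ltn_addr.
Qed.

Lemma hw_wf X : wf_gates (n + #|Z|) (hw_gates X) &&
  all (fun a => a < n + #|Z| + size (hw_gates X)) [tuple hw_out].
Proof.
rewrite size_hw_gates /= andbT wf_gates_cat size_map -cardE.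
rewrite compile_wf ?andbT; last exact: hw_wire_lt.
have -> /= : wf_gates (n + #|Z|) [seq GConst (X a) | a <- enum A].
  by elim: (enum A) (n + _) => //= a s IH l.
by rewrite /hw_out addnA prednK // addn_gt0 bsize_gt0 orbT.
Qed.

Definition hardwired (X : A -> bool) : coNcircuit n :=
  CoNCircuit (Circuit (hw_wf X)).

Lemma hardwired_size X :
  coN_size (hardwired X) = n + #|Z| + #|A| + bsize e.
Proof. by rewrite /coN_size /circuit_size size_hw_gates addnA. Qed.

Lemma hardwired_thead X (x : n.-tuple bool) (z : #|Z|.-tuple bool) :
  thead (eval_circuit (coN_circuit (hardwired X)) [tuple of x ++ z]) =
  beval (hw_env x X (fun t => tnth z (enum_rank t))) e.
Proof.
rewrite /thead tnth_map (tnth_nth 0) /= /hw_gates eval_wires_cat.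
have -> : forall y : bitseq, eval_wires [seq GConst (X a) | a <- enum A] y =
                    y ++ [seq X a | a <- enum A].
  elim: (enum A) => [|a s IH] y /=; first by rewrite cats0.
  by rewrite IH -cats1 -catA.
set y := (_ ++ _).
have sy : size y = n + #|Z| + #|A|.
  by rewrite !size_cat size_map -cardE !size_tuple.
have [s [ss es ns]] : exists s : bitseq, [/\ size s = bsize e,
    eval_wires (compile hw_wire (size y) e) y = y ++ s &
    nth false (y ++ s) (size y + bsize e).-1 =
      beval (fun t => nth false y (hw_wire t)) e].
  by apply: compile_eval; rewrite sy; exact: hw_wire_lt.
rewrite sy in es ns; rewrite es ns; apply: eq_beval => -[i|[a|t]] /=.
- by rewrite /y !nth_cat !size_cat !size_tuple ltn_addr // ltn_ord -tnth_nth.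
- rewrite /y nth_cat size_cat !size_tuple ltnNge leq_addr /= addKn.
  by rewrite (nth_map a) -?cardE // nth_enum_rank.
- rewrite /y !nth_cat !size_cat !size_tuple ltn_add2l ltn_ord.
  by rewrite ltnNge leq_addr /= addKn -tnth_nth.
Qed.

Lemma hardwiredP X (x : n.-tuple bool) :
  coN_eval (hardwired X) x <-> forall r, beval (hw_env x X r) e.
Proof.
split=> [/forallP H r|H]; last first.
  by apply/forallP=> z; rewrite hardwired_thead.
have := H [tuple r (enum_val i) | i < #|Z|]; rewrite hardwired_thead.
rewrite (@eq_beval _ _ (hw_env x X r)) // => -[//|[//|t]] /=.
by rewrite tnth_mktuple enum_rankK.
Qed.

(** The code is kept symbolic in [X], so that it can later be formed from guessed bits instead of
    known constants. *)
Definition hw_code (s : nat) : seq (bexp A) :=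
  let w := code_width s in
  map BConst (bits w #|Z| ++ bits w (#|A| + bsize e) ++ bits w hw_out) ++
  flatten [seq [:: BConst false; BConst false; BVar a] ++
             map BConst (bits w 0 ++ bits w 0) | a <- enum A] ++
  map BConst (flatten [seq code_gate w g |
    g <- compile hw_wire (n + #|Z| + #|A|) e]).

Lemma hw_codeE s X :
  coN_code_seq s (hardwired X) = [seq beval X c | c <- hw_code s].
Proof.
have mapK (u : bitseq) : [seq beval X c | c <- map BConst u] = u.
  by rewrite -map_comp map_id.
rewrite /hw_code !map_cat !mapK /coN_code_seq size_hw_gates -!catA.
do 3! congr (_ ++ _).
rewrite /hw_gates map_cat flatten_cat; congr (_ ++ _).
elim: (enum A) => //= a u ->.
by rewrite !map_cat !mapK.
Qed.

Lemma size_hw_code_bit s c : bsize (nth (BConst false) (hw_code s) c) = 1.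
Proof.
have nthC (T : Type) (u : bitseq) i :
    bsize (nth (@BConst T false) (map BConst u) i) = 1.
  have [iu|ui] := ltnP i (size u); first by rewrite (nth_map false).
  by rewrite nth_default // size_map.
rewrite /hw_code nth_cat; case: ifP => _; first exact: nthC.
rewrite nth_cat; case: ifP => _; last exact: nthC.
elim: (enum A) (c - _) => [|a u IH] i; first by rewrite nth_nil.
by case: i => [|[|[|i]]] //=; rewrite nth_cat; case: ifP.
Qed.

(** Past the end of [hw_code], the default [BConst false] supplies the zero padding of
    [coN_code]. *)
Lemma hw_code_bit s X (i : 'I_(code_len s)) :
  tnth (coN_code s (hardwired X)) i =
  beval X (nth (BConst false) (hw_code s) i).
Proof.
rewrite tnth_mktuple hw_codeE.
have [ic|ci] := ltnP i (size (hw_code s)); first exact: nth_map.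
by rewrite !nth_default ?size_map.
Qed.

End Hardwired.

(** * A polynomial-size verifier for SAT *)

Lemma size_code_form_gt0 n (p : form n) : 0 < size (code_form p).
Proof. by case: p. Qed.

Section Verifier.
Variable n : nat.

Definition parse_var : finType := ('I_n + 'I_n.+1 * 'I_n.+1 * bool)%type.
Definition sat_var : Type := ('I_n + parse_var)%type.

Definition input_lit (i : nat) (b : bool) : bexp sat_var :=
  if insub i is Some o then blit (BVar (inl o)) b else BConst false.

Fixpoint bmatch (i : nat) (s : bitseq) : bexp sat_var :=
  if s is b :: s' then BAnd (input_lit i b) (bmatch i.+1 s') else BConst true.

(* The guess that the input bits from position i to position j are the code of
   a formula of value v under the guessed assignment. *)
Definition parsed (i j : nat) (v : bool) : bexp sat_var :=
  BAnd (BConst ((i <= n) && (j <= n)))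
       (BVar (inr (inr (inord i, inord j, v)))).

Definition parsed_bin (op : bool -> bool -> bool) (tag : bitseq)
    (i j : nat) (v : bool) : bexp sat_var :=
  BAnd (bmatch i tag)
    (bex (enum (('I_n.+1 * bool * bool)%type : finType)) (fun m =>
       BAnd (BConst (op m.1.2 m.2 == v))
         (BAnd (parsed (i + 2) m.1.1 m.1.2) (parsed m.1.1 j m.2)))).

(** The five alternatives follow the constructors of [form], with the tags and lengths of
    [code_form]. *)
Definition parse_rule (i j : nat) (v : bool) : bexp sat_var :=
  BOr (BAnd (BConst (j == i + 3)) (bmatch i [:: false; false; v]))
  (BOr (BAnd (BConst (j == i + (3 + up_log 2 n)))
         (bex (enum 'I_n) (fun u =>
            BAnd (bmatch i ([:: false; true; false] ++ bits (up_log 2 n) u))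
              (blit (BVar (inr (inl u))) v))))
  (BOr (BAnd (bmatch i [:: false; true; true]) (parsed (i + 3) j (~~ v)))
  (BOr (parsed_bin andb [:: true; false] i j v)
       (parsed_bin orb [:: true; true] i j v)))).

(** Only claimed entries need a justification. The second conjunct asks for a true formula that
    starts at 0 and is followed by zeros up to the end. *)
Definition verifier : bexp sat_var :=
  BAnd
    (ball (enum (('I_n.+1 * 'I_n.+1 * bool)%type : finType)) (fun c =>
       BOr (BNot (parsed c.1.1 c.1.2 c.2)) (parse_rule c.1.1 c.1.2 c.2)))
    (bex (enum 'I_n.+1) (fun j : 'I_n.+1 =>
       BAnd (parsed 0 j true) (bmatch j (nseq (n - j) false)))).

Definition sat_env (x : n.-tuple bool) (r : parse_var -> bool)
    (t : sat_var) : bool :=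
  match t with inl i => tnth x i | inr z => r z end.

(** * Correctness of the guessed parse table *)

Section Correct.
Variables (x : n.-tuple bool) (r : parse_var -> bool).
Notation env := (sat_env x r).

(** An equation between suffixes also records that [s] fits into the input: [input_lit] is false
    beyond the end. *)
Lemma bmatchP i s :
  beval env (bmatch i s) <-> drop i x = s ++ drop (i + size s) x.
Proof.
elim: s i => [|b s IH] i /=; first by rewrite addn0.
have litE : beval env (input_lit i b) = (i < n) && (nth false x i == b).
  rewrite /input_lit; case: insubP => [o -> ov|/negbTE -> //].
  by rewrite beval_lit /= (tnth_nth false) ov.
rewrite litE -addSnnS; split=> [/andP[/andP[ltin /eqP <-]] /IH <-|e].
  by rewrite -drop_nth // size_tuple.
have ltin : i < n.
  rewrite ltnNge -[n](size_tuple x).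
  by apply/negP=> /drop_oversize e'; rewrite e' in e.
rewrite ltin /=; move: e; rewrite (drop_nth false) ?size_tuple //.
by case=> -> /IH ->; rewrite eqxx.
Qed.

(** The bounds keep out-of-range positions from being confused with 0, the value [inord] gives
    them. *)
Lemma parsedP i j v : reflect [/\ i <= n, j <= n &
    r (inr (inord i, inord j, v))] (beval env (parsed i j v)).
Proof. by rewrite /= -andbA; apply: and3P. Qed.

Definition assignment : n.-tuple bool := [tuple r (inl u) | u < n].

Definition parses (i j : nat) (v : bool) : Prop :=
  exists2 p, drop i x = code_form p ++ drop j x & eval_form assignment p = v.

Lemma parses_lt i j v : parses i j v -> j <= n -> i < j.
Proof.
move=> [p /(congr1 size)]; rewrite size_cat !size_drop size_tuple => + _.
by have := size_code_form_gt0 p; lia.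
Qed.

Lemma parses_bin (F : form n -> form n -> form n) op tag i j v :
  (forall p q, code_form (F p q) = tag ++ code_form p ++ code_form q) ->
  (forall a p q, eval_form a (F p q) = op (eval_form a p) (eval_form a q)) ->
  size tag = 2 ->
  (forall i' j' v', i < i' -> beval env (parsed i' j' v') -> parses i' j' v') ->
  beval env (parsed_bin op tag i j v) -> parses i j v.
Proof.
move=> codeF evalF st IH /bandP[/bmatchP ei]; rewrite beval_ex.
case/hasP=> -[[m v1] v2] _ /bandP[ev /bandP[P1 P2]].
rewrite /= in ev; move/eqP: ev => <-.
have [|p ep /= <-] := IH _ _ _ _ P1; first by lia.
(* The split point [m] is guessed freely. It lies beyond [i] because the first operand is already
   known to be a genuine, hence nonempty, code. *)
have im : i < m.
  suff : i + 2 < m by lia.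
  by apply: (parses_lt (ex_intro2 _ _ p ep erefl)); case/parsedP: P1.
have [q eq /= <-] := IH _ _ _ im P2.
by exists (F p q); rewrite ?evalF // codeF ei st ep eq -!catA.
Qed.

Lemma parse_rule_sound i j v :
  (forall i' j' v', i < i' -> beval env (parsed i' j' v') -> parses i' j' v') ->
  beval env (parse_rule i j v) -> parses i j v.
Proof.
move=> IH; case/borP=> [|/borP[|/borP[|]]].
- by case/bandP=> /eqP-> /bmatchP ei; exists (FConst n v).
- case/bandP=> /eqP->; rewrite beval_ex => /hasP[u _ /bandP[/bmatchP ei]].
  rewrite beval_lit => /eqP <-; exists (FVar u); last by rewrite /= tnth_mktuple.
  by rewrite ei size_cat size_bits.
- case/bandP=> /bmatchP ei /IH[|q eq ev]; first by lia.
  by exists (FNot q); rewrite ?ei ?eq //= ev negbK.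
- case/borP; [apply: (@parses_bin (@FAnd n))|apply: (@parses_bin (@FOr n))] => //.
Qed.

(** A justification rests on entries that start further right, so it cannot be circular: induction
    on [n - i] turns every claimed entry into an actual formula. *)
Lemma verifier_sound : beval env verifier -> SAT x.
Proof.
case/bandP; rewrite beval_all beval_ex => /allP rules.
have sound k i j v : n - i < k -> beval env (parsed i j v) -> parses i j v.
  elim: k i j v => // k IH i j v lek pij.
  have [lein lejn _] := parsedP _ _ _ pij.
  apply: parse_rule_sound => [i' j' v' lti pi'|].
    by apply: IH => //; case/parsedP: pi'; lia.
  have /= := rules (inord i, inord j, v) (mem_enum _ _).
  by rewrite !inordK // => /orP[/negP[]|].
case/hasP=> j _ /bandP[/(sound _ _ _ _ (ltnSn _))[p]].
rewrite drop0 => ex ep /bmatchP ej.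
exists p; last by exists assignment; rewrite ep.
exists (n - j); rewrite ex ej size_nseq drop_oversize ?cats0 // size_tuple.
by lia.
Qed.

End Correct.

(** Claiming exactly the true facts satisfies every rule: the outermost constructor of [p] selects
    the alternative, and its immediate subformulas supply the entries needed there. *)
Lemma parse_rule_complete (x : n.-tuple bool) (a : n.-tuple bool) i j v :
  let r (t : parse_var) := match t with
    | inl u => tnth a u
    | inr c => `[< exists2 p, drop c.1.1 x = code_form p ++ drop c.1.2 x &
                     eval_form a p = c.2 >]
    end in
  j <= n -> (exists2 p, drop i x = code_form p ++ drop j x & eval_form a p = v) ->
  beval (sat_env x r) (parse_rule i j v).
Proof.
move=> r lejn [p ei <-].
have szi := congr1 size ei; rewrite size_cat !size_drop size_tuple in szi.
have p_gt0 := size_code_form_gt0 p.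
have parsedI k l q : k <= n -> l <= n -> drop k x = code_form q ++ drop l x ->
    beval (sat_env x r) (parsed k l (eval_form a q)).
  move=> lek lel e; apply/parsedP; split=> //; apply/asboolP.
  by rewrite /= !inordK //; exists q.
have tagI (tag c : bitseq) : size tag <= n - i -> drop i x = tag ++ c ->
    drop (i + size tag) x = c /\ beval (sat_env x r) (bmatch i tag).
  move=> sz e; have ec : drop (i + size tag) x = c.
    by rewrite addnC -drop_drop e drop_size_cat.
  by split=> //; apply/bmatchP; rewrite ec.
have binI (op : bool -> bool -> bool) tag q1 q2 v' : size tag = 2 ->
    size tag + size (code_form q1) + size (code_form q2) <= n - i ->
    op (eval_form a q1) (eval_form a q2) = v' ->
    drop i x = tag ++ code_form q1 ++ code_form q2 ++ drop j x ->
    beval (sat_env x r) (parsed_bin op tag i j v').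
  move=> st sz <- e; have [|e1 b] := tagI _ _ _ e; first by lia.
  rewrite st in sz e1.
  have lt_m : i + 2 + size (code_form q1) < n.+1 by lia.
  apply/bandP; split=> //; rewrite beval_ex; apply/hasP.
  exists (Ordinal lt_m, eval_form a q1, eval_form a q2); first exact: mem_enum.
  have em : drop (i + 2 + size (code_form q1)) x = code_form q2 ++ drop j x.
    by rewrite addnC -drop_drop e1 drop_size_cat.
  apply/bandP; split; first by rewrite /= eqxx.
  by apply/bandP; split; apply: parsedI => //; rewrite ?e1 ?em //; lia.
case: p ei szi p_gt0 => [b|u|q|q1 q2|q1 q2] ei szi _; apply/borP.
- left; apply/bandP; split; first by rewrite /= in szi *; lia.
  by have [|_] := tagI [:: false; false; b] _ _ ei; first by rewrite /= in szi *; lia.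
- right; apply/borP; left; rewrite /= size_bits in szi.
  apply/bandP; split; first by rewrite /=; lia.
  rewrite beval_ex; apply/hasP; exists u; first by rewrite mem_enum.
  apply/bandP; split; last by rewrite beval_lit /=.
  by have [|_] := tagI _ _ _ ei; first by rewrite /= size_bits; lia.
- right; apply/borP; right; apply/borP; left; rewrite /= in szi.
  have [|e1 b] := tagI [:: false; true; true] _ _ ei; first by rewrite /=; lia.
  apply/bandP; split=> //; rewrite /= negbK; apply: parsedI => //; lia.
- right; apply/borP; right; apply/borP; right; apply/borP; left; rewrite /= !size_cat in szi.
  by apply: (binI andb _ q1 q2) => //=; [lia | rewrite ei /= -catA].
- right; apply/borP; right; apply/borP; right; apply/borP; right; rewrite /= !size_cat in szi.
  by apply: (binI orb _ q1 q2) => //=; [lia | rewrite ei /= -catA].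
Qed.

Lemma verifierP (x : n.-tuple bool) :
  SAT x <-> exists r, beval (sat_env x r) verifier.
Proof.
split=> [[p [k ex] [a ea]]|[r]]; last exact: verifier_sound.
exists (fun t : parse_var => match t with
    | inl u => tnth a u
    | inr c => `[< exists2 p, drop c.1.1 x = code_form p ++ drop c.1.2 x &
                     eval_form a p = c.2 >]
    end).
apply/bandP; split.
  rewrite beval_all; apply/allP=> -[[i j] v] _.
  set r := (fun t => _); apply/borP.
  have [/parsedP[lei lej]|] := boolP (beval (sat_env x r) (parsed i j v)).
    move=> /asboolP H; right; apply: parse_rule_complete => //.
    by move: H; rewrite /= !inordK.
  by left.
have szx := congr1 size ex; rewrite size_cat size_nseq size_tuple in szx.
have ltj : size (code_form p) < n.+1 by lia.
have dropE : drop (size (code_form p)) x = nseq k false.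
  by rewrite ex drop_size_cat.
rewrite beval_ex; apply/hasP; exists (Ordinal ltj); first by rewrite mem_enum.
apply/bandP; split.
  apply/parsedP; split=> //; apply/asboolP.
  by exists p; rewrite //= !inordK // drop0 dropE.
apply/bmatchP; rewrite [_ (Ordinal _)]/= size_nseq dropE.
have -> : n - size (code_form p) = k by lia.
by rewrite drop_oversize ?cats0 // size_tuple; lia.
Qed.

Lemma bsize_match i s : bsize (bmatch i s) <= (size s * 3).+1.
Proof.
elim: s i => //= b s IH i; have := IH i.+1.
have : bsize (input_lit i b) <= 2.
  by rewrite /input_lit; case: insubP => // o _ _; apply: bsize_lit.
by lia.
Qed.

End Verifier.

(** * Covering by values of a compression map *)

Section Cover.
Variables (U : finType) (t : nat) (f : {ffun 'I_t -> U} -> U).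
Hypothesis t_gt0 : 0 < t.
Hypothesis card_U : #|U| <= 2 ^ t.

Definition hit (S : {set U}) (y : U) : {set U} :=
  [set x | [exists F : {ffun 'I_t -> U},
     [&& F \in ffun_on (mem S), f F == y & [exists i, F i == x]]]].

Lemma hit_sub (S : {set U}) y : hit S y \subset S.
Proof.
apply/subsetP=> x; rewrite inE => /existsP[F /and3P[/ffun_onP FS _]].
by case/existsP=> i /eqP <-.
Qed.

(* All tuples over S mapped to y take their values in hit S y; summing
   #|hit S y| ^ t over y gives at least #|S| ^ t. *)
Lemma hit_half (S : {set U}) :
  S != set0 -> exists2 y, #|S| <= 2 * #|hit S y| & hit S y != set0.
Proof.
move=> S0; have S_gt0 : 0 < #|S| by rewrite card_gt0.
have [y ley|small] := pickP (fun y => #|S| <= 2 * #|hit S y|).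
  exists y => //; rewrite -card_gt0.
  by move: ley S_gt0; case: #|hit S y| => //; rewrite muln0 leqNgt => /negP.
have sumS : #|S| ^ t <= \sum_y #|hit S y| ^ t.
  rewrite -[t in #|S| ^ t]card_ord -card_ffun_on -sum1_card.
  rewrite (partition_big f predT) //=; apply: leq_sum => y _.
  rewrite -[t in _ ^ t]card_ord -card_ffun_on sum1_card.
  apply/subset_leq_card/subsetP=> F; rewrite !inE => /andP[FS fFy].
  apply/ffun_onP=> i; rewrite inE; apply/existsP; exists F.
  by rewrite FS fFy /=; apply/existsP; exists i.
have [y0 _] : exists y0, y0 \in S by apply/set0Pn.
(* If every hit set has less than half of [S], each [2 ^ t * #|hit S y| ^ t] is below [#|S| ^ t].
   Summed over the at most [2 ^ t] values [y], this contradicts [sumS]. *)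
have : 2 ^ t * #|S| ^ t < 2 ^ t * #|S| ^ t; last by rewrite ltnn.
apply: leq_ltn_trans (_ : 2 ^ t * \sum_y #|hit S y| ^ t < _).
  by rewrite leq_mul2l sumS orbT.
apply: (@leq_trans (#|U| * #|S| ^ t)); last by rewrite leq_mul2r card_U orbT.
(* Splitting off [y0] keeps the inequality between the sums strict: one term is strict, the others
   are compared weakly. *)
rewrite big_distrr /= -sum_nat_const (bigD1 y0) //= [X in _ < X](bigD1 y0) //=.
have lt y : 2 ^ t * #|hit S y| ^ t < #|S| ^ t.
  by rewrite -expnMn ltn_exp2r // ltnNge small.
by rewrite -addSn leq_add ?lt // leq_sum // => y _; apply/ltnW/lt.
Qed.

(** Greedy covering: each chosen value disposes of at least half of the remaining [D], so [m] of
    them exhaust fewer than [2 ^ m] elements. Tuples over [D] are tuples over [S], hence the chosen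
    values stay in [S]. *)
Lemma cover m (S D : {set U}) :
  D \subset S -> #|D| < 2 ^ m ->
  (forall F : {ffun 'I_t -> U}, (forall i, F i \in S) -> f F \in S) ->
  exists Y : seq U, [/\ size Y <= m, {subset Y <= S} &
    forall x, x \in D -> exists F : {ffun 'I_t -> U},
      f F \in Y /\ exists i, F i = x].
Proof.
move=> + + fS; elim: m D => [|m IH] D DS.
  rewrite expn0 ltnS leqn0 cards_eq0 => /eqP->.
  by exists [::]; split=> // x; rewrite inE.
move=> ltD; have [D0|/hit_half[y ley hy0]] := eqVneq D set0.
  by exists [::]; split=> // x; rewrite D0 inE.
have [||Y [sY YS covY]] := IH (D :\: hit D y) _ _.
- by apply: subset_trans DS; apply: subsetDl.
- have := cardsID (hit D y) D; rewrite (setIidPr (hit_sub D y)).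
  by move: ltD ley; rewrite expnS; lia.
exists (y :: Y); split=> //.
  move=> z; rewrite inE => /predU1P[->|/YS//].
  case/set0Pn: hy0 => x; rewrite inE => /existsP[F /and3P[/ffun_onP FD]].
  move=> /eqP <- _; apply: fS => i; exact: (subsetP DS) _ (FD i).
move=> x xD; have [xh|xh] := boolP (x \in hit D y).
  move: xh; rewrite inE => /existsP[F /and3P[_ /eqP fF /existsP[i /eqP Fi]]].
  by exists F; rewrite fF mem_head; split=> //; exists i.
have [|F [FY Fx]] := covY x; first by rewrite inE xh.
by exists F; rewrite inE FY orbT.
Qed.

End Cover.

(** * Polynomial bounds *)

(** The base [n.+2] is at least 2 for every [n], so constants and sums are absorbed by a larger
    exponent. *)
Definition poly_bounded (f : nat -> nat) : Prop :=
  exists c, forall n, f n <= n.+2 ^ c.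

Lemma poly_boundedW f g :
  (forall n, f n <= g n) -> poly_bounded g -> poly_bounded f.
Proof. by move=> fg [c gc]; exists c => n; apply: leq_trans (fg n) (gc n). Qed.

Lemma poly_bounded_const c : poly_bounded (fun=> c).
Proof.
exists c => n; apply: leq_trans (ltnW (ltn_expl c (ltnSn 1))) _.
by case: c => // c; rewrite leq_exp2r.
Qed.

Lemma poly_bounded_id : poly_bounded id.
Proof. by exists 1 => n; rewrite expn1; lia. Qed.

Lemma poly_boundedD f g :
  poly_bounded f -> poly_bounded g -> poly_bounded (fun n => f n + g n).
Proof.
move=> [a fa] [b gb]; exists (a + b).+1 => n.
have le_max : f n + g n <= 2 * n.+2 ^ (a + b).
  rewrite mul2n -addnn leq_add //.
    by rewrite (leq_trans (fa n)) // leq_exp2l // leq_addr.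
  by rewrite (leq_trans (gb n)) // leq_exp2l // leq_addl.
by rewrite expnS (leq_trans le_max) // leq_mul2r orbT.
Qed.

Lemma poly_boundedM f g :
  poly_bounded f -> poly_bounded g -> poly_bounded (fun n => f n * g n).
Proof. by move=> [a fa] [b gb]; exists (a + b) => n; rewrite expnD leq_mul. Qed.

Lemma poly_boundedS f : poly_bounded f -> poly_bounded (fun n => (f n).+1).
Proof.
move=> pf; apply: poly_boundedW (poly_boundedD pf (poly_bounded_const 1)) => n.
by rewrite addn1.
Qed.

Lemma poly_boundedX f c : poly_bounded f -> poly_bounded (fun n => f n ^ c).
Proof.
move=> [a fa]; exists (a * c) => n; rewrite expnM.
by case: c => // c; rewrite leq_exp2r.
Qed.

Lemma poly_bounded_expn f : poly_bounded f ->
  exists k, 1 <= k /\ forall n, 2 <= n -> f n <= n ^ k.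
Proof.
(* For [2 <= n] one has [n.+2 <= n ^ 2], hence the doubled exponent; the successor makes it
   positive. *)
move=> [c fc]; exists (2 * c).+1; split=> // n n2.
apply: leq_trans (fc n) (leq_trans (_ : _ <= n ^ (2 * c)) _).
  rewrite expnM; case: c {fc} => // c; rewrite leq_exp2r // expnS expn1.
  by nia.
by rewrite leq_exp2l // leqnSn.
Qed.

Ltac poly_bound :=
  repeat first [ apply: poly_bounded_const | apply: poly_bounded_id
    | assumption | apply: poly_boundedS | apply: poly_boundedD
    | apply: poly_boundedM | apply: poly_boundedX ].

(** * Size of the verifier *)

Lemma bsize_parsed_bin n op tag i j v : size tag = 2 ->
  bsize (@parsed_bin n op tag i j v) <= 40 * n.+1 + 10.
Proof.
move=> st; rewrite /parsed_bin /=.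
have := @bsize_match n i tag; rewrite st.
set F := (fun m => _).
have /(@bsize_ex _ _ (enum (('I_n.+1 * bool * bool)%type : finType)) F) :
  forall m, bsize (F m) <= 9 by [].
(* A split point and two truth values give [4 * n.+1] cases, each of cost at most 10. *)
rewrite -cardE !card_prod card_ord card_bool.
by set a := bsize (bex _ _); lia.
Qed.

Lemma bsize_parse_rule n i j v :
  bsize (@parse_rule n i j v) <= n * (3 * n + 15) + 80 * n.+1 + 55.
Proof.
have := @bsize_parsed_bin n andb [:: true; false] i j v erefl.
have := @bsize_parsed_bin n orb [:: true; true] i j v erefl.
have : _ <= 10 := @bsize_match n i [:: false; false; v].
have : _ <= 10 := @bsize_match n i [:: false; true; true].
rewrite /parse_rule; set F := (fun u => _).
have /(@bsize_ex _ _ (enum 'I_n) F) : forall u, bsize (F u) <= 3 * n + 13.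
  move=> u; rewrite /F !bsizeE.
  have w_le : up_log 2 n <= n by apply: up_log_min => //; apply/ltnW/ltn_expl.
  have := @bsize_match n i ([:: false; true; false] ++ bits (up_log 2 n) u).
  have -> : size ([:: false; true; false] ++ bits (up_log 2 n) u) =
    3 + up_log 2 n by rewrite size_cat size_bits.
  have := bsize_lit (BVar (inr (inl u) : sat_var n)) v.
  by rewrite !bsizeE; set a := bsize (blit _ _); lia.
by rewrite -cardE card_ord !bsizeE; set a := bsize (bex _ _); lia.
Qed.

Lemma poly_bounded_verifier : poly_bounded (fun n => bsize (verifier n)).
Proof.
apply: (@poly_boundedW _ (fun n => (n.+1 * n.+1 * 2) *
    ((n * (3 * n + 15) + 80 * n.+1 + 55) + 6) + n.+1 * (3 * n + 6) + 3));
  last by poly_bound.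
move=> n; rewrite /verifier; set F := (fun c => _); set G := (fun j => _).
have /(@bsize_all _ _ (enum (('I_n.+1 * 'I_n.+1 * bool)%type : finType)) F) :
    forall c, bsize (F c) <= (n * (3 * n + 15) + 80 * n.+1 + 55) + 5.
  move=> c; have := @bsize_parse_rule n c.1.1 c.1.2 c.2.
  by rewrite /F; set e := parse_rule _ _ _; rewrite /=; lia.
have /(@bsize_ex _ _ (enum 'I_n.+1) G) : forall j, bsize (G j) <= 3 * n + 5.
  move=> j; have := @bsize_match n j (nseq (n - j) false); rewrite size_nseq.
  by rewrite /G; set e := bmatch _ _; rewrite /=; lia.
rewrite -!cardE !card_prod !card_ord card_bool.
by set a := ball _ _; set b := bex _ _; rewrite [bsize (BAnd _ _)]/=; lia.
Qed.

(** * The query for the OR of n instances *)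

Definition sat_any n : bexp ('I_n + ('I_n * 'I_n + parse_var n)) :=
  BNot (bex (enum 'I_n) (fun i => bmap (fun t : sat_var n =>
    match t with
    | inl b => inr (inl (i, b))
    | inr z => inr (inr z)
    end) (verifier n))).

Definition entry n (F : {ffun 'I_n -> n.-tuple bool}) (a : 'I_n * 'I_n) : bool :=
  tnth (F a.1) a.2.

(** All copies of the verifier share one guess [r]. This suffices, since a single satisfiable entry
    already makes the negated disjunction fail. *)
Lemma sat_anyP n (F : {ffun 'I_n -> n.-tuple bool}) y :
  coN_eval (hardwired (sat_any n) (entry F)) y <-> ~ exists i, SAT (F i).
Proof.
have bmapE r i : beval (hw_env y (entry F) r) (bmap (fun t : sat_var n =>
    match t with inl b => inr (inl (i, b)) | inr z => inr (inr z) end)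
    (verifier n)) = beval (sat_env (F i) r) (verifier n).
  by rewrite beval_map; apply: eq_beval => -[b|z].
split=> [/hardwiredP H [i /verifierP[r ver]]|H]; last first.
  apply/hardwiredP => r; rewrite [beval _ _]/= beval_ex.
  apply/hasPn=> i _; rewrite bmapE; apply/negP=> ver.
  by apply: H; exists i; apply/verifierP; exists r.
have := H r; rewrite [beval _ _]/= beval_ex => /hasPn/(_ i).
by rewrite mem_enum bmapE ver => /(_ isT).
Qed.

(** By [hardwired_size], the sum is the size of the query. *)
Lemma poly_bounded_sat_any :
  poly_bounded (fun n => n + #|parse_var n| + n * n + bsize (sat_any n)).
Proof.
have pv := poly_bounded_verifier.
apply: (@poly_boundedW _ (fun n => n + (n + n.+1 * n.+1 * 2) + n * n +
    (n * (bsize (verifier n)).+1).+2)); last by poly_bound.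
move=> n; rewrite card_sum !card_prod !card_ord card_bool leq_add2l ltnS.
rewrite -[n in n * _.+1](card_ord n) cardE.
by apply: bsize_ex => i; rewrite bsize_map.
Qed.

(** * From a refuter to co-nondeterministic circuits for SAT *)

Section Decider.
Variables (n s : nat) (R : circuit (code_len s) n).

Definition query (F : {ffun 'I_n -> n.-tuple bool}) : coNcircuit n :=
  hardwired (sat_any n) (entry F).

Definition compress (F : {ffun 'I_n -> n.-tuple bool}) : n.-tuple bool :=
  eval_circuit R (coN_code s (query F)).

(** A guess consists of [n] instances and the values of all wires of [R] on their query. The [void]
    summand means that no constants are hardwired: the strings of [Y] enter through the shape of the
    expression. *)
Definition trace_var : finType :=
  ('I_n * 'I_n + 'I_(code_len s + size (gates R)))%type.
Definition dec_var : Type := ('I_n + (void + trace_var))%type.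

Definition wire_exp (w : nat) : bexp dec_var :=
  if insub w is Some o then BVar (inr (inr (inr o))) else BConst false.

Definition gate_exp (g : gate) : bexp dec_var :=
  match g with
  | GConst b => BConst b
  | GNot a => BNot (wire_exp a)
  | GAnd a b => BAnd (wire_exp a) (wire_exp b)
  | GOr a b => BOr (wire_exp a) (wire_exp b)
  end.

Definition code_exp (i : nat) : bexp dec_var :=
  bmap (fun a => inr (inr (inl a)))
    (nth (BConst false) (hw_code (sat_any n) s) i).

Definition trace_ok : bexp dec_var :=
  BAnd (ball (enum 'I_(code_len s)) (fun i : 'I_(code_len s) =>
          beqv (wire_exp i) (code_exp i)))
       (ball (enum 'I_(size (gates R))) (fun j : 'I_(size (gates R)) =>
          beqv (wire_exp (code_len s + j))
            (gate_exp (nth (GConst false) (gates R) j)))).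

Definition input_listed : bexp dec_var :=
  bex (enum 'I_n) (fun i => ball (enum 'I_n) (fun b =>
    beqv (BVar (inl b)) (BVar (inr (inr (inl (i, b))))))).

Definition output_in (Y : seq (n.-tuple bool)) : bexp dec_var :=
  bex Y (fun y => ball (enum 'I_n) (fun b =>
    blit (wire_exp (tnth (outs R) b)) (tnth y b))).

Definition decider (Y : seq (n.-tuple bool)) : bexp dec_var :=
  BNot (BAnd trace_ok (BAnd input_listed (output_in Y))).

Section Semantics.
Variables (x : n.-tuple bool) (X : void -> bool) (r : trace_var -> bool).
Notation env := (hw_env x X r).

Definition guess : {ffun 'I_n -> n.-tuple bool} :=
  [ffun i => [tuple r (inl (i, b)) | b < n]].

Definition trace : bitseq :=
  [tuple r (inr o) | o < code_len s + size (gates R)].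

Lemma beval_wire w : beval env (wire_exp w) = nth false trace w.
Proof.
rewrite /wire_exp; case: insubP => [o _ <-|].
  by rewrite -tnth_nth tnth_mktuple.
by rewrite -leqNgt => lew; rewrite nth_default // size_tuple.
Qed.

Lemma beval_gate g : beval env (gate_exp g) = eval_gate trace g.
Proof. by case: g => [b|a|a b|a b] //=; rewrite !beval_wire. Qed.

Lemma beval_code (i : 'I_(code_len s)) :
  beval env (code_exp i) = tnth (coN_code s (query guess)) i.
Proof.
rewrite beval_map hw_code_bit; apply: eq_beval => -[a b] /=.
by rewrite /entry ffunE tnth_mktuple.
Qed.

(** The first conjunct fixes the input wires to the code of the guessed query; by [eval_wiresP], the
    second makes the rest the run of [R]. *)
Lemma trace_okP : beval env trace_ok <->
  trace = eval_wires (gates R) (coN_code s (query guess)).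
Proof.
have sz : size trace = code_len s + size (gates R) by rewrite size_tuple.
have [wf _] := andP (circuit_wf R).
have inputs : beval env (ball (enum 'I_(code_len s))
      (fun i : 'I_(code_len s) => beqv (wire_exp i) (code_exp i))) <->
    take (code_len s) trace = coN_code s (query guess).
  have szt : size (take (code_len s) trace) = code_len s.
    by rewrite size_takel // sz leq_addr.
  rewrite beval_all; split=> [/allP H|e].
    apply: (@eq_from_nth _ false); rewrite ?szt ?size_tuple // => i lti.
    have := H (Ordinal lti) (mem_enum _ _).
    rewrite beval_eqv beval_wire beval_code => /eqP.
    by rewrite nth_take // (tnth_nth false).
  apply/allP=> i _; rewrite beval_eqv beval_wire beval_code.
  by rewrite (tnth_nth false) -e nth_take.
have gatesE : beval env (ball (enum 'I_(size (gates R)))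
      (fun j : 'I_(size (gates R)) => beqv (wire_exp (code_len s + j))
            (gate_exp (nth (GConst false) (gates R) j)))) <->
    trace = eval_wires (gates R) (take (code_len s) trace).
  rewrite (eval_wiresP wf sz) beval_all; split=> [/allP H j ltj|H].
    have := H (Ordinal ltj) (mem_enum _ _).
    by rewrite beval_eqv beval_wire beval_gate => /eqP.
  by apply/allP=> j _; rewrite beval_eqv beval_wire beval_gate H.
split=> [/bandP[/inputs e /gatesE]|e]; first by rewrite e.
have eI : take (code_len s) trace = coN_code s (query guess).
  have [u eu] := eval_wires_prefix (gates R) (coN_code s (query guess)).
  by rewrite e eu take_size_cat // size_tuple.
by apply/bandP; split; [apply/inputs | apply/gatesE; rewrite eI].
Qed.

Lemma input_listedP :
  reflect (exists i, guess i = x) (beval env input_listed).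
Proof.
rewrite beval_ex; apply: (iffP hasP) => [[i _]|[i <-]].
  rewrite beval_all => /allP H; exists i; apply: eq_from_tnth => b.
  have := H b (mem_enum _ _); rewrite beval_eqv => /eqP /= ->.
  by rewrite ffunE tnth_mktuple.
exists i; first by rewrite mem_enum.
rewrite beval_all; apply/allP=> b _; rewrite beval_eqv /=.
by rewrite ffunE tnth_mktuple.
Qed.

Lemma output_inP Y : reflect
  (exists2 y, y \in Y & tval y = map (nth false trace) (outs R))
  (beval env (output_in Y)).
Proof.
have outE y : beval env (ball (enum 'I_n) (fun b =>
      blit (wire_exp (tnth (outs R) b)) (tnth y b))) <->
    tval y = map (nth false trace) (outs R).
  rewrite beval_all; split=> [/allP H|e].
    suff -> : y = [tuple of map (nth false trace) (outs R)] by [].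
    apply: eq_from_tnth => b; rewrite tnth_map.
    by have := H b (mem_enum _ _); rewrite beval_lit beval_wire => /eqP.
  have -> : y = [tuple of map (nth false trace) (outs R)] by apply: val_inj.
  by apply/allP=> b _; rewrite beval_lit beval_wire tnth_map.
by rewrite beval_ex; apply: (iffP hasP) => -[y yY /outE e]; exists y.
Qed.

End Semantics.

Lemma deciderP Y X x :
  coN_eval (hardwired (decider Y) X) x <->
  ~ exists F, compress F \in Y /\ exists i, F i = x.
Proof.
rewrite hardwiredP; split=> [H [F [FY Fx]]|H r].
  (* The entries of [F] and the true wires of [R] on its query form a guess on which the decider
     rejects. *)
  pose v := eval_wires (gates R) (coN_code s (query F)).
  pose r (t : trace_var) := match t with
    | inl a => entry F a
    | inr o => nth false v o
    end.
  have gF : guess r = F.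
    apply/ffunP=> i; apply: eq_from_tnth => b.
    by rewrite ffunE tnth_mktuple.
  have tv : trace r = v.
    have sv : size v = code_len s + size (gates R).
      by rewrite size_eval_wires size_tuple.
    apply: (@eq_from_nth _ false); rewrite size_tuple // => i lti.
    rewrite -[i]/(val (Ordinal lti)) /trace -tnth_nth tnth_mktuple.
    by [].
  move/bnotP: (H r); apply.
  apply/bandP; split; first by apply/trace_okP; rewrite gF tv.
  apply/bandP; split; first by apply/input_listedP; rewrite gF.
  by apply/output_inP; exists (compress F); rewrite ?tv.
apply/bnotP=> /bandP[/trace_okP ok /bandP[/input_listedP gx]].
case/output_inP=> y yY ey; apply: H; exists (guess r); split=> //.
suff -> : compress (guess r) = y by [].
by apply: val_inj; rewrite /= ey ok.
Qed.

(** The factor 24 adds 10 for an input wire of [R] and 14 for a gate. *)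
Lemma bsize_decider Y : size Y <= n.+1 ->
  bsize (decider Y) <= 24 * circuit_size R + n * (n * 10 + 2) +
    n.+1 * (n * 3 + 2) + 8.
Proof.
move=> sY; rewrite /decider /trace_ok /circuit_size !bsizeE.
have wire1 w : bsize (wire_exp w) = 1.
  by rewrite /wire_exp; case: insubP.
set F := (fun i : 'I_(code_len s) => _).
set G := (fun j : 'I_(size (gates R)) => _).
have /(@bsize_all _ _ (enum 'I_(code_len s)) F) : forall i, bsize (F i) <= 9.
  by move=> i; rewrite /F !bsizeE wire1 bsize_map size_hw_code_bit.
have /(@bsize_all _ _ (enum 'I_(size (gates R))) G) :
    forall j, bsize (G j) <= 13.
  move=> j; rewrite /G !bsizeE wire1.
  by case: (nth _ _ _) => [b|a|a b|a b]; rewrite !bsizeE ?wire1.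
have : bsize input_listed <= (n * (n * 10).+2).+1.
  rewrite -[n in n * _.+2](size_enum_ord n); apply: bsize_ex => i.
  by rewrite -[n in n * _](size_enum_ord n); apply: bsize_all => b.
have : bsize (output_in Y) <= (size Y * (n * 3).+2).+1.
  apply: bsize_ex => y; rewrite -[n in n * _](size_enum_ord n).
  apply: bsize_all => b; apply: leq_trans (bsize_lit _ _) _.
  by rewrite wire1.
have : size Y * (n * 3).+2 <= n.+1 * (n * 3).+2 by rewrite leq_mul2r sY orbT.
rewrite !size_enum_ord.
set a := bsize (ball _ F); set b := bsize (ball _ G); lia.
Qed.

End Decider.

(** The list [Y] is chosen separately for each [n] and built into the circuit; since it has at most
    [n.+1] strings, the bound [g] is independent of the choice. *)
Lemma SAT_coNSIZE k (R : refuter_family k) n0 :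
  poly_size R ->
  (forall n, 2 <= n -> n + #|parse_var n| + n * n + bsize (sat_any n) <= n ^ k) ->
  (forall n, n0 <= n -> refutes_at R n) ->
  exists g, poly_bounded g /\ forall n, n0 <= n -> 2 <= n ->
    exists2 E : coNcircuit n, coN_size E <= g n &
      forall x, coN_eval E x <-> SAT x.
Proof.
move=> [c sizeR] fits refR.
exists (fun n => n + (n * n + (n ^ c + c)) + (24 * (n ^ c + c) +
  n * (n * 10 + 2) + n.+1 * (n * 3 + 2) + 8)); split; first by poly_bound.
move=> n n0n n2.
(* The query accepts iff no entry is satisfiable. Being wrong about [compress (R n) F] therefore
   means that this string is satisfiable iff some entry is. *)
have compressP F : SAT (compress (R n) F) <-> exists i, SAT (F i).
  have := refR n n0n (query F).
  rewrite hardwired_size card_prod card_ord => /(_ (fits n n2)).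
  rewrite /= -/(compress (R n) F) sat_anyP => nref.
  case: (pselect (exists i, SAT (F i))) => sF; split=> // sR.
    by apply: contrapT => nR; apply: nref; split.
  by exfalso; apply: nref; split.
pose U := [set x : n.-tuple bool | `[< ~ SAT x >]].
have memU x : x \in U <-> ~ SAT x by rewrite inE; split=> [/asboolP|/asboolP].
(* The bound [n.+1] comes from [#|U| <= 2 ^ n < 2 ^ n.+1]. Tuples of unsatisfiable strings are
   compressed to unsatisfiable strings by [compressP]. *)
have [||//|F FU|Y [sY YU covY]] :=
    @cover _ n (compress (R n)) _ _ n.+1 U U (subxx _).
- by lia.
- by rewrite card_tuple card_bool.
- by rewrite (leq_ltn_trans (max_card _)) // card_tuple card_bool ltn_exp2l.
- by apply/memU => /compressP[i]; apply/memU.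
exists (hardwired (decider (R n) Y) (fun v : void => match v with end)).
  rewrite hardwired_size card_void addn0 card_sum card_prod !card_ord.
  have := bsize_decider (R n) sY; have := sizeR n.
  by rewrite /circuit_size; set b := bsize _; lia.
(* An unsatisfiable [x] is covered by [Y], while a tuple containing a satisfiable [x] has a
   satisfiable image, which is outside [Y]. *)
move=> x; rewrite deciderP; split=> [H|sx [F [/YU/memU nF [i Fx]]]].
  by apply: contrapT => /memU/covY.
by apply: nF; apply/compressP; exists i; rewrite Fx.
Qed.

Theorem theorem3p4 :
  exists k : nat, 1 <= k /\
    ~ (exists R : refuter_family k,
         poly_size R /\
         exists n0 : nat, forall n : nat, n0 <= n -> refutes_at R n).
Proof.
apply: contrapT => none.
have refuter k : 1 <= k -> exists R : refuter_family k, poly_size R /\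
    exists n0 : nat, forall n : nat, n0 <= n -> refutes_at R n.
  by move=> k1; apply: contrapT => nR; apply: none; exists k.
(* The exponent [k] is determined by the queries alone, before any refuter is taken; [d] below
   depends on the refuter at [k]. *)
have [k [k1 fits]] := poly_bounded_expn poly_bounded_sat_any.
have [R [pR [n0 refR]]] := refuter k k1.
have [g [pg decide]] := SAT_coNSIZE pR fits refR.
have [d [d1 gd]] := poly_bounded_expn pg.
have [R' [_ [n1 refR']]] := refuter d d1.
(* At this length both refuters succeed and the bounds by powers of [n] apply; the circuit [E] that
   decides SAT cannot be refuted. *)
pose n := maxn 2 (maxn n0 n1).
have [||E sE EP] := decide n; rewrite ?leq_max ?leqnn ?orbT //.
apply: (refR' n _ E (leq_trans sE (gd n _)) (EP _));
  by rewrite ?leq_max ?leqnn ?orbT.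
Qed.
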